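(* Let $A$ be a non-unital, semisimple complex Banach algebra with unitization $A_e=A\oplus\mathbb{C}1$. Assume that $A$ has the spectral extension property (SEP). Then: (1) $A$ has P-property. (2) Every norm on $A$ majorizes a minimal norm on $A$. (3) $A_e$ has P-property. (4) Every norm on $A_e$ majorizes a minimal norm on $A_e$. (5) If $|\cdot|$ is a minimal norm on $A_e$, then the completion of $(A_e,|\cdot|)$ has P-property.
   Context: All algebras are associative and complex. A ''norm'' on an algebra always means a submultiplicative vector-space norm; it need not be complete and need not be related to any given norm. For a non-unital Banach algebra $(A,\|\cdot\|)$, the unitization $A_e=A\oplus\mathbb{C}1$ is a Banach algebra under $\|a+\lambda1\|_1=\|a\|+|\lambda|$. $r_A(a)$ is the spectral radius of $a$ in $A$ (the spectrum of $a$ is computed in $A_e$ if $A$ has no identity). Semisimple means that the Jacobson radical is $\{0\}$. SEP: a Banach algebra $B$ is a super Banach algebra of a Banach algebra $A$ if $A$ is a (not necessarily closed) subalgebra of $B$ (no relation between the norms is required). $A$ has the spectral extension property (SEP) if $r_A(a)=r_B(a)$ for all $a\in A$ and every super Banach algebra $B$ of $A$. P-property: for a Banach algebra $A$, the permanent spectral radius is $r_{pA}(a)=\inf\{|a|:|\cdot|\text{ is a norm on }A\}$ $(a\in A)$. $A$ has P-property if every nonzero closed (two-sided) ideal of $A$ (closed in the Banach algebra norm) contains an element $a$ with $r_{pA}(a)>0$. Minimal norm: a norm $|\cdot|$ on an algebra is minimal if every norm $|||\cdot|||$ on that algebra with $|||\cdot|||\le|\cdot|$ pointwise satisfies $|||\cdot|||=|\cdot|$.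 A norm $|||\cdot|||$ majorizes a norm $|\cdot|$ if $|\cdot|\le|||\cdot|||$ pointwise. *)

(* Defs.v *)
(* The complex numbers are R[i], over an arbitrary R : realType. *)
From HB Require Import structures.
From mathcomp Require Import all_boot all_order all_algebra.
From mathcomp Require Import complex.
From mathcomp Require Import boolp classical_sets reals topology normedtype.

Set Implicit Arguments.
Unset Strict Implicit.
Unset Printing Implicit Defensive.

Import Order.TTheory GRing.Theory Num.Theory.
Import numFieldNormedType.Exports.

Local Open Scope classical_set_scope.
Local Open Scope ring_scope.

Reserved Notation "x ** y" (at level 40, left associativity).

(* Associative algebras with no assumption on an identity element; the ring
   structures of the library all have one. *)
HB.mixin Record Lmodule_isNonUnitalAlgebra (K : comNzRingType) A
    of GRing.Lmodule K A := {
  nmul : A -> A -> A ;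
  nmulA : associative nmul ;
  nmulDl : left_distributive nmul +%R ;
  nmulDr : right_distributive nmul +%R ;
  nmulZl : forall (k : K) (x y : A), nmul (k *: x) y = k *: nmul x y ;
  nmulZr : forall (k : K) (x y : A), nmul x (k *: y) = k *: nmul x y
}.

#[short(type="nonUnitalAlgType")]
HB.structure Definition NonUnitalAlgebra (K : comNzRingType) :=
  { A of GRing.Lmodule K A & Lmodule_isNonUnitalAlgebra K A }.

Notation "x ** y" := (nmul x y) : ring_scope.

Section Algebra.
Context {K : comNzRingType}.
Implicit Type A : nonUnitalAlgType K.

Definition is_identity A (e : A) := forall x, e ** x = x /\ x ** e = x.

Definition has_identity A := exists e : A, is_identity e.

Definition invertible A (e x : A) := exists y, x ** y = e /\ y ** x = e.

Definition algebra_hom A (B : nonUnitalAlgType K) (f : {linear A -> B}) :=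
  forall x y, f (x ** y) = f x ** f y.

Definition is_subspace A (I : set A) :=
  I 0 /\ forall (k : K) (x y : A), I x -> I y -> I (k *: x + y).

Definition left_ideal A (I : set A) :=
  is_subspace I /\ forall x y, I y -> I (x ** y).

Definition ideal A (I : set A) :=
  is_subspace I /\ forall x y, I y -> I (x ** y) /\ I (y ** x).

Definition modular_left_ideal A (I : set A) :=
  left_ideal I /\ exists u, forall x, I (x - x ** u).

Definition maximal_modular_left_ideal A (M : set A) :=
  [/\ modular_left_ideal M, M <> setT &
      forall I : set A, left_ideal I -> M `<=` I -> I <> setT -> I = M].

(* When there is no maximal modular left ideal this is the whole algebra, the
   usual convention for radical algebras. *)
Definition jacobson_radical (A : nonUnitalAlgType K) : set A :=
  \bigcap_(M in [set M : set A | maximal_modular_left_ideal M]) M.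

Definition semisimple A := @jacobson_radical A = [set 0].

(* The pair (a, l) stands for a + l 1; K^o makes the product a K-module. *)
Definition unitization A : Type := (A * K^o)%type.

HB.instance Definition _ A := GRing.Lmodule.on (unitization A).

Definition unitization_mul A (x y : unitization A) : unitization A :=
  (x.1 ** y.1 + (x.2 : K) *: y.1 + (y.2 : K) *: x.1, (x.2 : K) * y.2).

Section UnitizationLaws.
Variable A : nonUnitalAlgType K.
Implicit Types x y z : unitization A.

Lemma unitization_mulDl : left_distributive (@unitization_mul A) +%R.
Proof.
move=> [a k] [b l] [c m]; congr pair => /=; last by rewrite mulrDl.
rewrite nmulDl scalerDl scalerDr [RHS]addrACA; congr (_ + _); exact: addrACA.
Qed.

Lemma unitization_mulDr : right_distributive (@unitization_mul A) +%R.
Proof.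
move=> [a k] [b l] [c m]; congr pair => /=; last by rewrite mulrDr.
rewrite nmulDr scalerDl scalerDr [RHS]addrACA; congr (_ + _); exact: addrACA.
Qed.

Lemma unitization_mulZl (k : K) x y :
  unitization_mul (k *: x) y = k *: unitization_mul x y.
Proof.
case: x y => [a l] [b m]; congr pair => /=; last by rewrite -mulrA.
by rewrite nmulZl !scalerDr !scalerA [m * k]mulrC.
Qed.

Lemma unitization_mulZr (k : K) x y :
  unitization_mul x (k *: y) = k *: unitization_mul x y.
Proof.
case: x y => [a l] [b m]; congr pair => /=; last by rewrite mulrCA.
by rewrite nmulZr !scalerDr !scalerA [l * k]mulrC.
Qed.

Lemma unitization_mulA : associative (@unitization_mul A).
Proof.
move=> [a k] [b l] [c m]; congr pair => /=; last by rewrite mulrA.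
rewrite !(nmulDl, nmulDr, nmulZl, nmulZr, scalerDr, scalerA) nmulA.
by rewrite [m * k]mulrC [m * l]mulrC !addrA [LHS](ACl (1*4*2*5*3*6*7)%AC).
Qed.

HB.instance Definition _ := Lmodule_isNonUnitalAlgebra.Build K (unitization A)
  unitization_mulA unitization_mulDl unitization_mulDr
  unitization_mulZl unitization_mulZr.

End UnitizationLaws.

Definition unitization_inj A (a : A) : unitization A := (a, 0).

Definition unitization_one A : unitization A := (0, 1).

End Algebra.

Section Norms.
Context {R : realType}.
Local Notation C := R[i].
Local Notation normc := Normc.normc.
Implicit Type A : nonUnitalAlgType C.

Record algNorm A := AlgNorm {
  algnorm :> A -> R ;
  algnormD : forall x y, algnorm (x + y) <= algnorm x + algnorm y ;
  algnormZ : forall (k : C) x, algnorm (k *: x) = normc k * algnorm x ;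
  algnorm_eq0 : forall x, algnorm x = 0 -> x = 0 ;
  algnormM : forall x y, algnorm (x ** y) <= algnorm x * algnorm y
}.

Definition normed_by A (N : algNorm A) : Type := A.

Section NormedBy.
Variables (A : nonUnitalAlgType C) (N : algNorm A).

Let norm (x : normed_by N) : C := (N x)%:C%C.

Let ler_norm (x y : A) : norm (x + y) <= norm x + norm y.
Proof. by rewrite /norm -rmorphD lecR algnormD. Qed.

Let normZ (k : C) (x : A) : norm (k *: x) = `|k| * norm x.
Proof. by rewrite /norm algnormZ rmorphM. Qed.

Let norm_eq0 (x : A) : norm x = 0 -> x = 0.
Proof. by move=> /eqP; rewrite fmorph_eq0 => /eqP; exact: algnorm_eq0. Qed.

HB.instance Definition _ := GRing.Lmodule.on (normed_by N).
HB.instance Definition _ :=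
  Lmodule_isNormed.Build C (normed_by N) ler_norm normZ norm_eq0.

End NormedBy.

(* An algebra together with a complete norm is a Banach algebra. *)
Definition complete_norm A (N : algNorm A) :=
  forall F : set_system (normed_by N), ProperFilter F -> cauchy F -> cvg F.

Definition unitization_norm_fun A (N : algNorm A) (x : unitization A) : R :=
  N x.1 + normc (x.2 : C).

Section UnitizationNorm.
Variables (A : nonUnitalAlgType C) (N : algNorm A).
Local Notation N1 := (unitization_norm_fun N).

Lemma unitization_normD x y : N1 (x + y) <= N1 x + N1 y.
Proof.
rewrite /unitization_norm_fun addrACA lerD//; first exact: algnormD.
exact: le_normcD.
Qed.

Lemma unitization_normZ (k : C) x : N1 (k *: x) = normc k * N1 x.
Proof.
rewrite /unitization_norm_fun /= algnormZ mulrDr; congr (_ + _).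
exact: Normc.normcM.
Qed.

Lemma algnorm_ge0 (B : nonUnitalAlgType C) (M : algNorm B) x : 0 <= M x.
Proof. by have := normr_ge0 (x : normed_by M); rewrite lecR. Qed.

Lemma normc_ge0 (k : C) : 0 <= normc k.
Proof. by have := normr_ge0 k; rewrite lecR. Qed.

Lemma unitization_norm_eq0 x : N1 x = 0 -> x = 0.
Proof.
case: x => a k /eqP.
rewrite paddr_eq0 ?algnorm_ge0 ?normc_ge0// => /andP[/eqP a0 /eqP k0].
by congr pair; [exact: algnorm_eq0 a0 | exact: Normc.eq0_normc].
Qed.

Lemma unitization_normM x y : N1 (x ** y) <= N1 x * N1 y.
Proof.
case: x y => [a k] [b l]; rewrite /unitization_norm_fun /=.
rewrite Normc.normcM mulrDl !mulrDr addrA lerD2r.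
apply: (le_trans (algnormD N _ _)); rewrite algnormZ [normc l * _]mulrC.
rewrite addrAC lerD2r; apply: (le_trans (algnormD N _ _)).
by rewrite algnormZ lerD2r algnormM.
Qed.

Definition unitization_norm : algNorm (unitization A) :=
  AlgNorm unitization_normD unitization_normZ unitization_norm_eq0
          unitization_normM.

End UnitizationNorm.

Definition spectrum A (a : A) : set C :=
  [set l : C |
    (exists2 e : A, is_identity e & ~ invertible e (l *: e - a)) \/
    (~ has_identity A /\
     ~ invertible (unitization_one A)
         (l *: unitization_one A - unitization_inj a))].

Definition spectral_radius A (a : A) : R :=
  sup [set normc l | l in spectrum a].

(* A super Banach algebra of A is presented by an injective homomorphism of A
   into a Banach algebra B. *)
Definition SEP A :=
  forall (B : nonUnitalAlgType C) (NB : algNorm B), complete_norm NB ->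
  forall iota : {linear A -> B}, algebra_hom iota -> injective iota ->
  forall a : A, spectral_radius a = spectral_radius (iota a).

Definition permanent_radius A (a : A) : R :=
  inf [set N a | N in [set: algNorm A]].

Definition P_property A (N : algNorm A) :=
  forall I : set A, ideal I -> closed (I : set (normed_by N)) ->
  (exists x, I x /\ x <> 0) ->
  exists a, I a /\ 0 < permanent_radius a.

Definition majorizes A (N M : algNorm A) := forall x, M x <= N x.

Definition minimal_norm A (N : algNorm A) :=
  forall M : algNorm A, majorizes N M -> forall x, M x = N x.

(* The completion of (A, N), determined up to isometric isomorphism. *)
Definition is_completion A (N : algNorm A) (B : nonUnitalAlgType C)
    (NB : algNorm B) (iota : {linear A -> B}) :=
  [/\ complete_norm NB, algebra_hom iota, forall x, NB (iota x) = N x &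
      dense (range iota : set (normed_by NB))].

End Norms.

(* Main.v *)
(* SEP applied to the completion of (A, M) gives r(a) <= M a for every norm M,
   hence r(a) <= r_p(a).  An ideal on which r_p vanishes therefore consists of
   quasi-invertible elements and lies in the Jacobson radical, so every nonzero
   ideal of A, closed or not, contains an a with r_p(a) > 0.  This passes to the
   unitization, because A is non-unital and so meets every nonzero ideal of A_e,
   and it makes the infimum of a chain of norms a norm again (its kernel is an
   ideal on which r_p vanishes), so Zorn's lemma yields the minimal norms.
   For (5), a closed ideal I of the completion with trivial trace on A_e would
   make x |-> d(x, I) a norm below the minimal norm, hence equal to it; by
   density this forces I = 0. *)
Require Import Defs.
From HB Require Import structures.
From mathcomp Require Import all_boot all_order all_algebra complex.
From mathcomp Require Import boolp classical_sets reals topology normedtype.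
From mathcomp Require Import functions sequences ring lra.

Set Implicit Arguments.
Unset Strict Implicit.
Unset Printing Implicit Defensive.

Import Order.TTheory GRing.Theory Num.Theory.
Import numFieldNormedType.Exports.

Local Open Scope classical_set_scope.
Local Open Scope ring_scope.
Local Open Scope quotient_scope.

(** * Computation rules for products *)

Section NonUnitalAlgebra.
Context {K : comNzRingType} {A : nonUnitalAlgType K}.
Implicit Types x y z : A.

Lemma nmul0l x : 0 ** x = 0.
Proof. by rewrite -{1}(scale0r (0 : A)) nmulZl scale0r. Qed.

Lemma nmul0r x : x ** 0 = 0.
Proof. by rewrite -{1}(scale0r (0 : A)) nmulZr scale0r. Qed.

Lemma nmulNl x y : (- x) ** y = - (x ** y).
Proof. by rewrite -scaleN1r nmulZl scaleN1r. Qed.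

Lemma nmulNr x y : x ** (- y) = - (x ** y).
Proof. by rewrite -scaleN1r nmulZr scaleN1r. Qed.

Lemma nmulBl x y z : (x - y) ** z = x ** z - y ** z.
Proof. by rewrite nmulDl nmulNl. Qed.

Lemma nmulBr x y z : x ** (y - z) = x ** y - x ** z.
Proof. by rewrite nmulDr nmulNr. Qed.

(** Product rule for differences: it makes the product of classes well defined and the product of
    Cauchy sequences Cauchy. *)
Lemma nmulB2 x y x' y' : x' ** y' - x ** y = (x' - x) ** y' + x ** (y' - y).
Proof. by rewrite nmulBl nmulBr addrA subrK. Qed.

End NonUnitalAlgebra.

(** * Quotient of an algebra by the kernel of a submultiplicative seminorm *)

Section SeminormQuotient.
Context {R : realType}.
Local Notation C := R[i].
Local Notation normc := Normc.normc.

Variables (E : nonUnitalAlgType C) (p : E -> R).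

(** Kept apart from [algNorm] because limits and infima of norms satisfy these laws before, or
    without, being definite. *)
Record seminorm_axioms : Prop := SeminormAxioms {
  seminormD : forall x y, p (x + y) <= p x + p y ;
  seminormZ : forall (k : C) x, p (k *: x) = normc k * p x ;
  seminormM : forall x y, p (x ** y) <= p x * p y }.

Hypothesis p_seminorm : seminorm_axioms.

Lemma seminorm0 : p 0 = 0.
Proof. by rewrite -(scale0r (0 : E)) (seminormZ p_seminorm) Normc.normc0 mul0r. Qed.

Lemma seminormN x : p (- x) = p x.
Proof.
rewrite -scaleN1r (seminormZ p_seminorm) -[RHS]mul1r; congr (_ * _).
by rewrite /= oppr0 sqrrN expr1n expr0n addr0 sqrtr1.
Qed.

Lemma seminorm_ge0 x : 0 <= p x.
Proof.
have := seminormD p_seminorm x (- x).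
by rewrite subrr seminorm0 seminormN -mulr2n pmulrn_lge0.
Qed.

Lemma seminormB x y : p (x - y) <= p x + p y.
Proof. by rewrite -[p y]seminormN (seminormD p_seminorm). Qed.

Definition seminorm_ker : {pred E} := fun x => p x == 0.

Lemma seminorm_ker_zmod : zmod_closed seminorm_ker.
Proof.
split=> [|x y]; first by rewrite unfold_in seminorm0.
rewrite !unfold_in => /eqP px /eqP py; rewrite eq_le seminorm_ge0 andbT.
by rewrite (le_trans (seminormB _ _))// px py addr0.
Qed.

HB.instance Definition _ :=
  GRing.isZmodClosed.Build E seminorm_ker seminorm_ker_zmod.

Definition seminorm_quot := Quotient.quot seminorm_ker.
HB.instance Definition _ := Quotient.on seminorm_quot.
HB.instance Definition _ := GRing.Zmodule.on seminorm_quot.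

Local Notation Q := seminorm_quot.
Local Notation pi x := (\pi_Q x : Q).

Lemma seminorm_quot_eqP x y : reflect (pi x = pi y) (p (x - y) == 0).
Proof. by rewrite [_ == 0](Quotient.idealrBE seminorm_ker x y); exact: eqP. Qed.

Lemma seminorm_quotD x y : pi (x + y) = pi x + pi y.
Proof. by rewrite raddfD. Qed.

Lemma seminorm_repr x : p (repr (pi x) - x) = 0.
Proof. by apply/eqP/seminorm_quot_eqP; rewrite reprK. Qed.

(** Both operations go through chosen representatives; they respect classes because the kernel of
    [p] absorbs scalars and products. *)
Definition seminorm_quot_scale (k : C) (x : Q) : Q := pi (k *: repr x).
Definition seminorm_quot_mul (x y : Q) : Q := pi (repr x ** repr y).

Lemma seminorm_quotZ k x : pi (k *: x) = seminorm_quot_scale k (pi x).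
Proof.
apply/esym/seminorm_quot_eqP.
by rewrite -scalerBr (seminormZ p_seminorm) seminorm_repr mulr0.
Qed.

Lemma seminorm_quotM x y : pi (x ** y) = seminorm_quot_mul (pi x) (pi y).
Proof.
apply/esym/seminorm_quot_eqP; rewrite nmulB2 eq_le seminorm_ge0 andbT.
apply: le_trans (seminormD p_seminorm _ _) _.
apply: le_trans (lerD (seminormM p_seminorm _ _) (seminormM p_seminorm _ _)) _.
by rewrite !seminorm_repr mulr0 mul0r addr0.
Qed.

(** Read from right to left, these rules turn an expression in classes into the class of an
    expression in [E], so each algebra law of the quotient comes from the same law in [E]. *)
Let quotE := (seminorm_quotD, seminorm_quotZ, seminorm_quotM).
Let pi_repr (x : Q) : x = pi (repr x). Proof. by rewrite reprK. Qed.

Fact seminorm_quot_scaleA a b x :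
  seminorm_quot_scale a (seminorm_quot_scale b x) = seminorm_quot_scale (a * b) x.
Proof. by rewrite (pi_repr x) -!quotE scalerA. Qed.

Fact seminorm_quot_scale1 : left_id 1 seminorm_quot_scale.
Proof. by move=> x; rewrite (pi_repr x) -!quotE scale1r. Qed.

Fact seminorm_quot_scaleDr : right_distributive seminorm_quot_scale +%R.
Proof. by move=> a x y; rewrite (pi_repr x) (pi_repr y) -!quotE scalerDr. Qed.

Fact seminorm_quot_scaleDl x : {morph seminorm_quot_scale^~ x : a b / a + b}.
Proof. by move=> a b; rewrite (pi_repr x) -!quotE scalerDl. Qed.

HB.instance Definition _ := GRing.Zmodule_isLmodule.Build C Q
  seminorm_quot_scaleA seminorm_quot_scale1 seminorm_quot_scaleDr
  seminorm_quot_scaleDl.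

Fact seminorm_quot_mulA : associative seminorm_quot_mul.
Proof.
by move=> x y z; rewrite (pi_repr x) (pi_repr y) (pi_repr z) -!quotE nmulA.
Qed.

Fact seminorm_quot_mulDl : left_distributive seminorm_quot_mul +%R.
Proof.
by move=> x y z; rewrite (pi_repr x) (pi_repr y) (pi_repr z) -!quotE nmulDl.
Qed.

Fact seminorm_quot_mulDr : right_distributive seminorm_quot_mul +%R.
Proof.
by move=> x y z; rewrite (pi_repr x) (pi_repr y) (pi_repr z) -!quotE nmulDr.
Qed.

Fact seminorm_quot_mulZl (k : C) (x y : Q) :
  seminorm_quot_mul (k *: x) y = k *: seminorm_quot_mul x y.
Proof.
by rewrite /GRing.scale/= (pi_repr x) (pi_repr y) -!quotE nmulZl.
Qed.

Fact seminorm_quot_mulZr (k : C) (x y : Q) :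
  seminorm_quot_mul x (k *: y) = k *: seminorm_quot_mul x y.
Proof.
by rewrite /GRing.scale/= (pi_repr x) (pi_repr y) -!quotE nmulZr.
Qed.

HB.instance Definition _ := Lmodule_isNonUnitalAlgebra.Build C Q
  seminorm_quot_mulA seminorm_quot_mulDl seminorm_quot_mulDr
  seminorm_quot_mulZl seminorm_quot_mulZr.

Definition seminorm_pi (x : E) : Q := pi x.

Fact seminorm_pi_linear : linear seminorm_pi.
Proof. by move=> k x y; rewrite /seminorm_pi seminorm_quotD seminorm_quotZ. Qed.

HB.instance Definition _ :=
  GRing.isLinear.Build C E Q *:%R seminorm_pi seminorm_pi_linear.

Lemma seminorm_piM : algebra_hom seminorm_pi.
Proof. by move=> x y; exact: seminorm_quotM. Qed.

Lemma seminorm_pi_surj (x : Q) : exists y, x = seminorm_pi y.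
Proof. by exists (repr x); exact: pi_repr. Qed.

Definition quot_norm (x : Q) : R := p (repr x).

Lemma quot_normE x : quot_norm (seminorm_pi x) = p x.
Proof.
apply/eqP; rewrite /quot_norm eq_le -{1}(subrK x (repr _)).
rewrite (le_trans (seminormD p_seminorm _ _)) ?seminorm_repr ?add0r//=.
rewrite -{1}(subKr (repr (pi x)) x) (le_trans (seminormB _ _))//.
by rewrite seminorm_repr addr0.
Qed.

Fact quot_normD x y : quot_norm (x + y) <= quot_norm x + quot_norm y.
Proof.
have [{}x ->] := seminorm_pi_surj x; have [{}y ->] := seminorm_pi_surj y.
by rewrite -raddfD !quot_normE (seminormD p_seminorm).
Qed.

Fact quot_normZ (k : C) x : quot_norm (k *: x) = normc k * quot_norm x.
Proof.
have [{}x ->] := seminorm_pi_surj x.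
by rewrite -linearZ !quot_normE (seminormZ p_seminorm).
Qed.

Fact quot_norm_eq0 x : quot_norm x = 0 -> x = 0.
Proof.
have [{}x ->] := seminorm_pi_surj x; rewrite quot_normE => x0.
by rewrite -[RHS](raddf0 seminorm_pi); apply/seminorm_quot_eqP; rewrite subr0 x0.
Qed.

Fact quot_normM x y : quot_norm (x ** y) <= quot_norm x * quot_norm y.
Proof.
have [{}x ->] := seminorm_pi_surj x; have [{}y ->] := seminorm_pi_surj y.
by rewrite -seminorm_piM !quot_normE (seminormM p_seminorm).
Qed.

Definition quot_algnorm : algNorm Q :=
  AlgNorm quot_normD quot_normZ quot_norm_eq0 quot_normM.

End SeminormQuotient.

(** * Elementary properties of algebra norms *)

Section AlgNormTheory.
Context {R : realType} {A : nonUnitalAlgType R[i]}.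
Local Notation normc := Normc.normc.
Implicit Types (N : algNorm A) (x y z : A).

Lemma algnorm_seminorm N : seminorm_axioms N.
Proof. by split; [exact: algnormD | exact: algnormZ | exact: algnormM]. Qed.

Definition seminorm_algnorm (p : A -> R) (p_seminorm : seminorm_axioms p)
    (p_eq0 : forall x, p x = 0 -> x = 0) : algNorm A :=
  AlgNorm (seminormD p_seminorm) (seminormZ p_seminorm) p_eq0
          (seminormM p_seminorm).

Lemma algnorm0 N : N 0 = 0. Proof. exact: seminorm0 (algnorm_seminorm N). Qed.

Lemma algnormN N x : N (- x) = N x.
Proof. exact: seminormN (algnorm_seminorm N) x. Qed.

Lemma algnorm_distC N x y : N (x - y) = N (y - x).
Proof. by rewrite -algnormN opprB. Qed.

Lemma algnorm_dist_triangle N y x z : N (x - z) <= N (x - y) + N (y - z).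
Proof. by rewrite -[in leLHS](subrK y x) -addrA algnormD. Qed.

Lemma algnorm_dist_split N y x z (e : R) :
  N (x - y) < e / 2 -> N (y - z) < e / 2 -> N (x - z) < e.
Proof.
move=> xy yz; apply: le_lt_trans (algnorm_dist_triangle N y x z) _.
by rewrite (splitr e) ltrD.
Qed.

Lemma algnorm_gt0 N x : x <> 0 -> 0 < N x.
Proof.
move=> x0; rewrite lt_def algnorm_ge0 andbT.
by apply/eqP => /algnorm_eq0.
Qed.

End AlgNormTheory.

Lemma normc_gt0 (R : realType) (k : R[i]) : k != 0 -> 0 < Normc.normc k.
Proof.
move=> k0; rewrite lt_def normc_ge0 andbT.
by apply: contra_neq k0; exact: Normc.eq0_normc.
Qed.

(** * Submultiplicative seminorms defined as infima *)

Section InfSeminorm.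
Context {R : realType} {E : nonUnitalAlgType R[i]}.
Local Notation normc := Normc.normc.
(** [S x] collects admissible bounds for [x]. The hypotheses ask only for some bound not above the
    expected one, which covers eventual bounds of a sequence, values of a chain of norms, and
    distances to the points of an ideal. *)
Variable S : E -> set R.
Hypothesis S_neq0 : forall x, S x !=set0.
Hypothesis S_ge0 : forall x r, S x r -> 0 <= r.
Hypothesis SD : forall x y r s, S x r -> S y s ->
  exists2 t, S (x + y) t & t <= r + s.
Hypothesis SZ : forall (k : R[i]) x r, S x r ->
  exists2 t, S (k *: x) t & t <= normc k * r.
Hypothesis SM : forall x y r s, S x r -> S y s ->
  exists2 t, S (x ** y) t & t <= r * s.

Local Notation p := (fun x => inf (S x)).

Lemma inf_seminorm_le x r : S x r -> p x <= r.
Proof. by move=> Sr; apply: ge_inf => //; exists 0 => ? /S_ge0. Qed.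

Let p_ge0 x : 0 <= p x.
Proof. by apply: (lb_le_inf (S_neq0 _)) => ? /S_ge0. Qed.

Let pZ_le (k : R[i]) x : p (k *: x) <= normc k * p x.
Proof.
have [->|k0] := eqVneq k 0.
  rewrite scale0r Normc.normc0 mul0r; have [r /(SZ 0)[t]] := S_neq0 0.
  by rewrite scale0r Normc.normc0 mul0r => /inf_seminorm_le; exact: le_trans.
have nk := normc_gt0 k0.
rewrite mulrC -ler_pdivrMr//; apply: (lb_le_inf (S_neq0 _)) => r /(SZ k)[t St tr].
by rewrite ler_pdivrMr// mulrC (le_trans (inf_seminorm_le St)).
Qed.

Lemma inf_seminorm : seminorm_axioms p.
Proof.
split=> [x y|k x|x y].
- rewrite -lerBlDr; apply: (lb_le_inf (S_neq0 _)) => r Sr.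
  rewrite lerBlDr -lerBlDl; apply: (lb_le_inf (S_neq0 _)) => s Ss.
  rewrite lerBlDl; have [t St] := SD Sr Ss.
  exact: le_trans (inf_seminorm_le St).
- apply/eqP; rewrite eq_le pZ_le/=; have [->|k0] := eqVneq k 0.
    by rewrite Normc.normc0 mul0r.
  have nk := normc_gt0 k0.
  (* The reverse inequality is [pZ_le] for the scalar [k^-1] and the vector [k *: x]. *)
  rewrite -ler_pdivlMl// -Normc.normcV; apply: le_trans (pZ_le _ _).
  by rewrite scalerA mulVf// scale1r.
(* The infimum is taken over the bounds for [y] with [r] fixed, then over [r]. Each time one divides
   by the fixed factor, so its value 0 is treated apart. *)
- have pM_le r : S x r -> p (x ** y) <= r * p y.
    move=> Sr; have := S_ge0 Sr; rewrite le_eqVlt => /predU1P[r0|r0].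
      have [s /(SM Sr)[t St]] := S_neq0 y; rewrite -r0 !mul0r.
      exact: le_trans (inf_seminorm_le St).
    rewrite mulrC -ler_pdivrMr//.
    apply: (lb_le_inf (S_neq0 _)) => s /(SM Sr)[t St ts].
    by rewrite ler_pdivrMr// mulrC (le_trans (inf_seminorm_le St)).
  have := p_ge0 y; rewrite le_eqVlt => /predU1P[y0|y0].
    have [r /pM_le] := S_neq0 x; by rewrite -y0 !mulr0.
  rewrite -ler_pdivrMr//; apply: (lb_le_inf (S_neq0 _)) => r /pM_le.
  by rewrite ler_pdivrMr.
Qed.

End InfSeminorm.

(** * Completeness in terms of sequences *)

Lemma eventually_invS_lt (R : realType) (e : R) : 0 < e ->
  exists n0, forall n, (n0 <= n)%N -> n.+1%:R^-1 < e.
Proof.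
move=> e0; have [n0] := ltr_add_invr e0; rewrite add0r => n0e.
exists n0 => n n0n; apply: le_lt_trans n0e.
by rewrite lef_pV2 ?posrE ?ltr0n// ler_nat.
Qed.

Section Sequences.
Context {R : realType} {A : nonUnitalAlgType R[i]}.
Implicit Types (N : algNorm A) (u : nat -> A) (l : A).

Definition cauchy_sequence N u := forall e : R, 0 < e ->
  exists n0, forall m n, (n0 <= m)%N -> (n0 <= n)%N -> N (u m - u n) < e.

Definition sequence_cvg N u l := forall e : R, 0 < e ->
  exists n0, forall n, (n0 <= n)%N -> N (u n - l) < e.

Lemma normed_by_ball N (x y : normed_by N) (e : R) :
  ball x e%:C%C y = (N ((x : A) - y) < e) :> Prop.
Proof. by rewrite -ball_normE /ball_/= ltcR. Qed.

(** Balls of [normed_by N] have complex radii; a positive complex number is real, so real radii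
    suffice. *)
Lemma complex_gt0P (e : R[i]) : 0 < e -> exists2 r : R, 0 < r & e = r%:C%C.
Proof.
move=> e0; have eE : e = (complex.Re e)%:C%C by rewrite RRe_real// gtr0_real.
by exists (complex.Re e) => //; rewrite -ltcR -eE.
Qed.

Lemma complete_norm_sequence N u :
  complete_norm N -> cauchy_sequence N u -> exists l, sequence_cvg N u l.
Proof.
move=> cN cu; pose v : nat -> normed_by N := u.
have vF : ProperFilter (v @ \oo) by exact: fmap_proper_filter.
have /(cN _ vF)/cvg_ex[l vl] : cauchy (v @ \oo).
  apply: cauchy_exP => _ /complex_gt0P[e e0 ->]; have [n0 n0P] := cu _ e0.
  exists (v n0); exists n0 => // n /= n0n.
  by rewrite normed_by_ball; exact: n0P.
exists l => e e0; have eC : 0 < e%:C%C by rewrite ltcR.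
have /cvg_ballP/(_ _ eC)[n0 _ n0P] := vl.
by exists n0 => n /n0P/=; rewrite normed_by_ball algnorm_distC.
Qed.

(** For a Cauchy filter [F], choose centers [u n] of balls of radius [1/(n+1)] that belong to [F].
    Any two of these balls meet, so the centers form a Cauchy sequence, and its limit is a limit of
    [F]. *)
Lemma sequence_complete_norm N :
  (forall u, cauchy_sequence N u -> exists l, sequence_cvg N u l) ->
  complete_norm N.
Proof.
move=> sN F FF /cauchyP Fc.
have inv_gt0 n : 0 < n.+1%:R^-1 :> R by rewrite invr_gt0.
have /choice[u uP] n : exists x : normed_by N, F (ball x (n.+1%:R^-1)%:C%C).
  by apply: Fc; rewrite ltcR.
have F_close m n : N ((u m : A) - u n) < m.+1%:R^-1 + n.+1%:R^-1.
  have /(@filter_ex _ F)[z []] : F (ball (u m) (m.+1%:R^-1)%:C%C `&`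
      ball (u n) (n.+1%:R^-1)%:C%C) by exact: filterI.
  rewrite !normed_by_ball => uz uz'.
  apply: le_lt_trans (algnorm_dist_triangle N z (u m) (u n)) _.
  by rewrite ltrD// algnorm_distC.
have [e e0|l ul] := sN u.
  have [n0 n0P] := eventually_invS_lt (divr_gt0 e0 (ltr0Sn _ 1)).
  exists n0 => m n n0m n0n; apply: lt_trans (F_close _ _) _.
  by rewrite (splitr e) ltrD// n0P.
apply/cvg_ex; exists l; apply/cvg_ballP => _ /complex_gt0P[e e0 ->].
have e2 : 0 < e / 2 by rewrite divr_gt0.
have [n1 n1P] := eventually_invS_lt e2; have [n2 n2P] := ul _ e2.
have /n1P n1n := leq_maxl n1 n2; have /n2P n2n := leq_maxr n1 n2.
apply: filterS (uP (maxn n1 n2)) => z.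
rewrite !normed_by_ball => uz; rewrite algnorm_distC.
apply: algnorm_dist_split n2n.
by rewrite algnorm_distC (lt_trans uz).
Qed.

End Sequences.

(** * Completion of a normed algebra by Cauchy sequences *)

Section CauchySequences.
Context {R : realType} {A : nonUnitalAlgType R[i]}.
Local Notation C := R[i].
Local Notation normc := Normc.normc.
Variable N : algNorm A.

Lemma cauchy_sequence_const (a : A) : cauchy_sequence N (fun=> a).
Proof. by move=> e e0; exists 0%N => m n _ _; rewrite subrr algnorm0. Qed.

Lemma cauchy_sequence_bounded u : cauchy_sequence N u ->
  exists2 M, 0 < M & exists n0, forall n, (n0 <= n)%N -> N (u n) <= M.
Proof.
move=> /(_ 1 ltr01)[n0 n0P].
exists (1 + N (u n0)); first by rewrite ltr_pwDl// algnorm_ge0.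
exists n0 => n n0n; rewrite -{1}(subrK (u n0) (u n)).
by rewrite (le_trans (algnormD _ _ _))// lerD2r ltW// n0P.
Qed.

Lemma cauchy_sequenceD u v : cauchy_sequence N u -> cauchy_sequence N v ->
  cauchy_sequence N (fun n => u n + v n).
Proof.
move=> cu cv e e0; have e2 : 0 < e / 2 by rewrite divr_gt0.
have [n1 n1P] := cu _ e2; have [n2 n2P] := cv _ e2.
exists (maxn n1 n2) => m n; rewrite !geq_max => /andP[m1 m2] /andP[k1 k2].
rewrite opprD addrACA (le_lt_trans (algnormD _ _ _))// (splitr e).
by rewrite ltrD ?n1P ?n2P.
Qed.

Lemma cauchy_sequenceZ (k : C) u : cauchy_sequence N u ->
  cauchy_sequence N (fun n => k *: u n).
Proof.
(* Adding 1 keeps the divisor positive when [k] is 0. *)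
move=> cu e e0; have k1 : 0 < normc k + 1 by rewrite ltr_wpDl// normc_ge0.
have [n0 n0P] := cu _ (divr_gt0 e0 k1); exists n0 => m n m0 k0.
rewrite -scalerBr algnormZ; have := n0P _ _ m0 k0.
rewrite ltr_pdivlMr// mulrC; apply: le_lt_trans.
by rewrite ler_wpM2r ?algnorm_ge0// lerDl.
Qed.

Lemma cauchy_sequenceM u v : cauchy_sequence N u -> cauchy_sequence N v ->
  cauchy_sequence N (fun n => u n ** v n).
Proof.
move=> cu cv e e0.
have [Mu Mu0 [nu nuP]] := cauchy_sequence_bounded cu.
have [Mv Mv0 [nv nvP]] := cauchy_sequence_bounded cv.
have e2 : 0 < e / 2 by rewrite divr_gt0.
have [n1 n1P] := cu _ (divr_gt0 e2 Mv0); have [n2 n2P] := cv _ (divr_gt0 e2 Mu0).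
exists (maxn (maxn nu nv) (maxn n1 n2)) => m n.
rewrite !geq_max => /andP[/andP[mu mv] /andP[m1 m2]].
move=> /andP[/andP[ku kv] /andP[k1 k2]].
rewrite nmulB2 (le_lt_trans (algnormD _ _ _))// (splitr e) ltrD//.
  apply: le_lt_trans (algnormM _ _ _) _; have := n1P _ _ m1 k1.
  rewrite ltr_pdivlMr//; apply: le_lt_trans.
  by rewrite ler_wpM2l ?algnorm_ge0// nvP.
apply: le_lt_trans (algnormM _ _ _) _; have := n2P _ _ m2 k2.
rewrite ltr_pdivlMr// mulrC; apply: le_lt_trans.
by rewrite ler_wpM2r ?algnorm_ge0// nuP.
Qed.

(** Boolean-valued, so that the Cauchy sequences inherit their module structure as a submodule of
    all sequences. *)
Definition cauchy_pred : {pred (nat -> A)} := fun u => `[< cauchy_sequence N u >].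

Lemma cauchy_pred_submod : submod_closed cauchy_pred.
Proof.
split=> [|k u v /asboolP cu /asboolP cv]; apply/asboolP.
  exact: cauchy_sequence_const.
by apply: (cauchy_sequenceD (cauchy_sequenceZ k cu) cv).
Qed.

HB.instance Definition _ :=
  GRing.isSubmodClosed.Build C (nat -> A) cauchy_pred cauchy_pred_submod.

Definition cauchy_seq : Type := {u : nat -> A | u \in cauchy_pred}.
HB.instance Definition _ := SubType.on cauchy_seq.
HB.instance Definition _ := Choice.on cauchy_seq.
HB.instance Definition _ := [SubChoice_isSubLmodule of cauchy_seq by <:].

Lemma cauchy_seqP (u : cauchy_seq) : cauchy_sequence N (val u).
Proof. exact/asboolP/(valP u). Qed.

Definition CauchySeq u (cu : cauchy_sequence N u) : cauchy_seq :=
  exist _ u (asboolT cu).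

Definition cauchy_mul (u v : cauchy_seq) : cauchy_seq :=
  CauchySeq (cauchy_sequenceM (cauchy_seqP u) (cauchy_seqP v)).

Fact cauchy_mulA : associative cauchy_mul.
Proof. by move=> u v w; apply/val_inj/funext => n /=; rewrite nmulA. Qed.

Fact cauchy_mulDl : left_distributive cauchy_mul +%R.
Proof. by move=> u v w; apply/val_inj/funext => n; exact: nmulDl. Qed.

Fact cauchy_mulDr : right_distributive cauchy_mul +%R.
Proof. by move=> u v w; apply/val_inj/funext => n; exact: nmulDr. Qed.

Fact cauchy_mulZl (k : C) u v : cauchy_mul (k *: u) v = k *: cauchy_mul u v.
Proof. by apply/val_inj/funext => n; exact: nmulZl. Qed.

Fact cauchy_mulZr (k : C) u v : cauchy_mul u (k *: v) = k *: cauchy_mul u v.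
Proof. by apply/val_inj/funext => n; exact: nmulZr. Qed.

HB.instance Definition _ := Lmodule_isNonUnitalAlgebra.Build C cauchy_seq
  cauchy_mulA cauchy_mulDl cauchy_mulDr cauchy_mulZl cauchy_mulZr.

Definition eventual_bounds (u : cauchy_seq) : set R :=
  [set r | exists n0, forall n, (n0 <= n)%N -> N (val u n) <= r].

Lemma eventual_bounds_neq0 u : eventual_bounds u !=set0.
Proof.
have [M _ [n0 n0P]] := cauchy_sequence_bounded (cauchy_seqP u).
by exists M, n0.
Qed.

Lemma eventual_bounds_ge0 u r : eventual_bounds u r -> 0 <= r.
Proof. by case=> n0 /(_ _ (leqnn n0)); apply/le_trans/algnorm_ge0. Qed.

(** This is the limit superior of [N (u n)]. Written as an infimum, it falls under
    [inf_seminorm]. *)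
Definition limit_norm (u : cauchy_seq) : R := inf (eventual_bounds u).

Lemma limit_norm_le u r n0 :
  (forall n, (n0 <= n)%N -> N (val u n) <= r) -> limit_norm u <= r.
Proof.
move=> n0P; apply: (@inf_seminorm_le _ _ eventual_bounds) => //; last by exists n0.
exact: eventual_bounds_ge0.
Qed.

Lemma limit_norm_seminorm : seminorm_axioms limit_norm.
Proof.
apply: inf_seminorm.
- exact: eventual_bounds_neq0.
- exact: eventual_bounds_ge0.
- move=> u v r s [n1 n1P] [n2 n2P]; exists (r + s) => //.
  exists (maxn n1 n2) => n; rewrite geq_max => /andP[n1n n2n].
  by rewrite (le_trans (algnormD _ _ _))// lerD ?n1P ?n2P.
- move=> k u r [n0 n0P]; exists (normc k * r) => //; exists n0 => n n0n.
  by rewrite algnormZ ler_wpM2l ?normc_ge0 ?n0P.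
- move=> u v r s [n1 n1P] [n2 n2P]; exists (r * s) => //.
  exists (maxn n1 n2) => n; rewrite geq_max => /andP[n1n n2n].
  by rewrite (le_trans (algnormM _ _ _))// ler_pM ?algnorm_ge0 ?n1P ?n2P.
Qed.

Definition completion := seminorm_quot limit_norm_seminorm.
HB.instance Definition _ := NonUnitalAlgebra.on completion.

Definition completion_norm : algNorm completion := quot_algnorm limit_norm_seminorm.

Definition const_seq (a : A) : cauchy_seq := CauchySeq (cauchy_sequence_const a).

Fact const_seq_linear : linear const_seq.
Proof. by move=> k a b; exact: val_inj. Qed.

HB.instance Definition _ :=
  GRing.isLinear.Build C A cauchy_seq *:%R const_seq const_seq_linear.

Lemma limit_norm_const a : limit_norm (const_seq a) = N a.
Proof.
apply/eqP; rewrite eq_le (@limit_norm_le _ _ 0)//=.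
apply: lb_le_inf; first exact: eventual_bounds_neq0.
by move=> r [n0 /(_ _ (leqnn n0))].
Qed.

Definition completion_inj : A -> completion :=
  seminorm_pi limit_norm_seminorm \o const_seq.
HB.instance Definition _ := GRing.Linear.on completion_inj.

Lemma completion_injE a : completion_norm (completion_inj a) = N a.
Proof. by rewrite [LHS]quot_normE limit_norm_const. Qed.

Lemma completion_injM : algebra_hom completion_inj.
Proof.
move=> a b; rewrite -[RHS]seminorm_piM; congr (seminorm_pi _ _).
exact: val_inj.
Qed.

Lemma completion_inj_injective : injective completion_inj.
Proof.
move=> a b ab; apply/eqP; rewrite -subr_eq0; apply/eqP/(algnorm_eq0 (a:=N)).
rewrite -completion_injE [completion_inj _]raddfB.
by move/eqP: ab; rewrite -subr_eq0 => /eqP ->; exact: algnorm0.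
Qed.

(** Diagonal argument: the [n]-th class is within [1/(n+1)] of a constant sequence [a n]; the
    elements [a n] form a Cauchy sequence in [A], and its class is the limit. *)
Lemma completion_complete : complete_norm completion_norm.
Proof.
apply: sequence_complete_norm => u cu.
pose p := limit_norm; pose pS := limit_norm_seminorm.
have normE x : completion_norm (seminorm_pi pS x) = p x by exact: quot_normE.
have /choice[x xE] n : exists x, u n = seminorm_pi pS x by exact: seminorm_pi_surj.
have p_dist m n : p (x m - x n) = completion_norm (u m - u n).
  by rewrite -normE raddfB /= -!xE.
have p_triangle y z w : p (z - w) <= p (z - y) + p (y - w).
  by rewrite -[in leLHS](subrK y z) -addrA (seminormD pS).
have p_distC y z : p (y - z) = p (z - y).
  by rewrite -[in LHS]opprB; exact: seminormN pS _.
have /choice[a aP] n : exists b, p (x n - const_seq b) <= n.+1%:R^-1.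
  have n0 : 0 < n.+1%:R^-1 :> R by rewrite invr_gt0.
  have [k kP] := cauchy_seqP (x n) n0; exists (val (x n) k).
  by apply: (@limit_norm_le _ _ k) => m km; rewrite ltW//; exact: kP.
have pN b c : p (const_seq b - const_seq c) = N (b - c).
  by rewrite -raddfB [LHS]limit_norm_const.
have small (e : R) : 0 < e -> exists n0, forall n, (n0 <= n)%N ->
    p (x n - const_seq (a n)) < e.
  move=> /eventually_invS_lt[n0 n0P]; exists n0 => n /n0P.
  exact: le_lt_trans (aP n).
have ca : cauchy_sequence N a.
  move=> e e0; have e3 : 0 < e / 3 by rewrite divr_gt0.
  have [n1 n1P] := small _ e3; have [n2 n2P] := cu _ e3.
  exists (maxn n1 n2) => m n; rewrite !geq_max => /andP[m1 m2] /andP[k1 k2].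
  rewrite -pN; apply: le_lt_trans (p_triangle (x m) _ _) _.
  have -> : e = e / 3 + (e / 3 + e / 3) by lra.
  apply: ltr_leD; first by rewrite p_distC n1P.
  apply: le_trans (p_triangle (x n) _ _) _.
  by rewrite lerD ?p_dist// ltW// ?n1P ?n2P.
exists (seminorm_pi pS (CauchySeq ca)) => e e0.
have e2 : 0 < e / 2 by rewrite divr_gt0.
have [n1 n1P] := small _ e2; have [n2 n2P] := ca _ e2.
exists (maxn n1 n2) => n; rewrite geq_max => /andP[k1 k2].
rewrite xE -raddfB [ltLHS]normE.
apply: le_lt_trans (p_triangle (const_seq (a n)) _ _) _.
rewrite (splitr e) ltr_leD ?n1P//.
by apply: (@limit_norm_le _ _ n2) => m m2; rewrite ltW//; exact: n2P.
Qed.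

End CauchySequences.

(** * Quasi-inverses by the Neumann series *)

Section QuasiInverse.
Context {R : realType} {B : nonUnitalAlgType R[i]}.
Implicit Types (N : algNorm B) (u v : nat -> B) (x y l : B).

Lemma algnorm_small_eq N x y : (forall e : R, 0 < e -> N (x - y) < e) -> x = y.
Proof.
move=> small; apply/eqP; rewrite -subr_eq0; apply/eqP; apply: contrapT => xy.
by have := small _ (algnorm_gt0 N xy); rewrite ltxx.
Qed.

Lemma sequence_cvg_unique N u x y :
  sequence_cvg N u x -> sequence_cvg N u y -> x = y.
Proof.
move=> ux uy; apply: (algnorm_small_eq (N := N)) => e e0.
have e2 : 0 < e / 2 by rewrite divr_gt0.
have [n1 n1P] := ux _ e2; have [n2 n2P] := uy _ e2.
apply: algnorm_dist_split (n2P _ (leq_maxr n1 n2)).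
by rewrite algnorm_distC n1P ?leq_maxl.
Qed.

Lemma sequence_cvg_dominated N u v x y (M : R) : sequence_cvg N u x ->
  (forall n, N (v n - y) <= M * N (u n - x)) -> sequence_cvg N v y.
Proof.
(* [M] may be zero or negative, hence the constant [|M| + 1]. *)
move=> ux vM e e0; have M1 : 0 < `|M| + 1 by rewrite ltr_wpDl.
have [n0 n0P] := ux _ (divr_gt0 e0 M1); exists n0 => n /n0P.
rewrite ltr_pdivlMr// mulrC; apply/le_lt_trans/(le_trans (vM _)).
by rewrite ler_wpM2r ?algnorm_ge0// (le_trans (ler_norm M))// lerDl.
Qed.

(** The two equations say that [1 - y] is a two-sided inverse of [1 - x]. Here [y] is minus the sum
    of the powers [x, x^2, ...]; the partial sums [s n] are the iterates from 0 of the map sending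
    [z] to [x z - x]. *)
Lemma complete_quasi_inverse N x : complete_norm N -> N x < 1 ->
  exists y, x + y = x ** y /\ x + y = y ** x.
Proof.
move=> cN x1; pose s := fix s n := if n is n'.+1 then x ** s n' - x else 0.
pose q := N x; have q0 : 0 <= q by exact: algnorm_ge0.
have q1 : 0 < 1 - q by rewrite subr_gt0.
(* [K] is the sum of [q^n] over [n >= 1], the fixed point of [K = q K + q]. *)
pose K := q / (1 - q); have K0 : 0 <= K by rewrite divr_ge0// ltW.
have sK n : N (s n) <= K.
  elim: n => [|n IH] /=; first by rewrite algnorm0.
  apply: le_trans (algnormD _ _ _) _; rewrite algnormN -/q.
  have -> : K = q * K + q.
    by rewrite /K; field; rewrite gt_eqF.
  by rewrite lerD2r (le_trans (algnormM _ _ _))// ler_wpM2l.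
(* The difference is [x^n] times [s m], since each step of the recursion takes out one factor
   [x]. *)
have sq m n : N (s (n + m)%N - s n) <= q ^+ n * K.
  elim: n => [|n IH]; first by rewrite add0n subr0 expr0 mul1r.
  rewrite addSn /= opprB addrA subrK -nmulBr (le_trans (algnormM _ _ _))//.
  by rewrite exprS -mulrA ler_wpM2l.
have qK : (fun n => q ^+ n * K) @ \oo --> 0.
  rewrite -(mul0r K); apply: cvgMl; apply: cvg_expr.
  by rewrite ger0_norm.
have cs : cauchy_sequence N s.
  move=> e e0; have e2 : 0 < e / 2 by rewrite divr_gt0.
  have /cvgrPdist_lt/(_ _ e2)[n0 _ /(_ n0 (leqnn _))/=] := qK.
  rewrite sub0r normrN (ger0_norm (mulr_ge0 (exprn_ge0 _ q0) K0)) => n0P.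
  have close m : (n0 <= m)%N -> N (s m - s n0) < e / 2.
    by move=> /subnKC <-; apply: le_lt_trans n0P.
  exists n0 => m n /close m0 /close k0.
  by apply: algnorm_dist_split m0 _; rewrite algnorm_distC.
have [y sy] := complete_norm_sequence cN cs.
have sS : sequence_cvg N (fun n => s n.+1) y.
  by move=> e /sy[n0 n0P]; exists n0 => n n0n; apply: n0P; exact: leqW.
have xs : sequence_cvg N (fun n => x ** s n) (x ** y).
  by apply: (sequence_cvg_dominated (M := q) sy) => n; rewrite -nmulBr algnormM.
have sx : sequence_cvg N (fun n => s n ** x) (y ** x).
  apply: (sequence_cvg_dominated (M := q) sy) => n.
  by rewrite -nmulBl mulrC algnormM.
(* The recursion multiplies by [x] on the left only; the other equation follows because [x] commutes
   with the partial sums. *)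
have comm n : x ** s n = s n ** x.
  elim: n => [|n IH] /=; first by rewrite nmul0l nmul0r.
  by rewrite nmulBr nmulBl IH nmulA IH.
have xy : x ** y = y ** x.
  by apply: sequence_cvg_unique xs _; under eq_fun do rewrite comm.
have xyE : x + y = x ** y.
  rewrite addrC; apply: (sequence_cvg_unique (N := N) _ xs).
  apply: (sequence_cvg_dominated (M := 1) sS) => n.
  by rewrite mul1r /= opprD addrA [x ** s n - y - x]addrAC.
by exists y; rewrite -xy.
Qed.

Lemma quasi_inverse_invertible (e x y : B) (k : R[i]) :
  is_identity e -> k != 0 -> x + y = x ** y -> x + y = y ** x ->
  invertible e (k *: e - k *: x).
Proof.
move=> e1 k0 xy yx; have eM z : e ** z = z by have [] := e1 z.
have Me z : z ** e = z by have [] := e1 z.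
exists (k^-1 *: (e - y)); rewrite -scalerBr !(nmulZl, nmulZr) !scalerA.
rewrite divff// mulVf// !scale1r !(nmulBl, nmulBr) !eM !Me -xy -yx.
by rewrite opprB addrK subrK.
Qed.

Lemma is_identity_unitization_one : is_identity (unitization_one B).
Proof.
move=> [a k]; split; congr pair => /=.
- by rewrite nmul0l scale1r scaler0 addr0 add0r.
- by rewrite mul1r.
- by rewrite nmul0r scale1r scaler0 !add0r.
- by rewrite mulr1.
Qed.

End QuasiInverse.

(** * Embedding of an algebra in its unitization *)

Section UnitizationInjection.
Context {K : comNzRingType} {A : nonUnitalAlgType K}.

Fact unitization_inj_linear : linear (@unitization_inj K A).
Proof. by move=> k a b; congr pair; rewrite /= ?scaler0 ?addr0. Qed.

HB.instance Definition _ := GRing.isLinear.Build K A (unitization A) *:%R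
  (@unitization_inj K A) unitization_inj_linear.

Lemma unitization_injM : algebra_hom (@unitization_inj K A).
Proof. by move=> a b; congr pair; rewrite /= ?scale0r ?addr0 ?mul0r. Qed.

Lemma unitization_inj_injective : injective (@unitization_inj K A).
Proof. by move=> a b []. Qed.

End UnitizationInjection.

(** * Bounds for the spectral radius by norms *)

Section SpectralRadius.
Context {R : realType}.
Local Notation C := R[i].
Local Notation normc := Normc.normc.

Section CompleteNorm.
Context {B : nonUnitalAlgType C} (N : algNorm B).
Hypothesis N_complete : complete_norm N.

(** If [N b < |l|], then [b / l] has norm below 1 and so a quasi-inverse, which makes
    [l - b = l (1 - b / l)] invertible. The quasi-inverse lies in [B] itself, so the argument is the
    same with an identity in [B] and in the unitization. *)
Lemma spectrum_le_norm (b : B) l : spectrum b l -> normc l <= N b.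
Proof.
move=> lb; rewrite leNgt; apply/negP => bl.
have nl : 0 < normc l by rewrite (le_lt_trans _ bl)// algnorm_ge0.
have l0 : l != 0 by apply: contraTN nl => /eqP ->; rewrite Normc.normc0 ltxx.
have [|y [xy yx]] := @complete_quasi_inverse _ _ N (l^-1 *: b) N_complete.
  by rewrite algnormZ Normc.normcV mulrC ltr_pdivrMr ?mul1r.
have bE : b = l *: (l^-1 *: b) by rewrite scalerA divff// scale1r.
case: lb => [[e e1 []]|[_ []]].
  by rewrite bE; exact: quasi_inverse_invertible xy yx.
have injD (p q : B) :
    unitization_inj (p + q) = unitization_inj p + unitization_inj q.
  exact: raddfD.
rewrite bE [unitization_inj _]linearZ.
apply: (quasi_inverse_invertible (y := unitization_inj y)) => //.
- exact: is_identity_unitization_one.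
- by rewrite -injD xy unitization_injM.
- by rewrite -injD yx unitization_injM.
Qed.

Lemma spectral_radius_le_norm (b : B) : spectral_radius b <= N b.
Proof.
rewrite /spectral_radius.
(* The spectrum has not been shown to be nonempty; the supremum of the empty set is 0 by
   convention. *)
have [->|/set0P s0] := eqVneq [set normc l | l in spectrum b] set0.
  by rewrite sup0 algnorm_ge0.
by apply: ge_sup => // _ [l /spectrum_le_norm lb <-].
Qed.

Lemma spectrum_le_radius (b : B) l : spectrum b l -> normc l <= spectral_radius b.
Proof.
move=> lb; apply: ub_le_sup; last by exists l.
by exists (N b) => _ [m /spectrum_le_norm mb <-].
Qed.

End CompleteNorm.

(** [N] is any norm, complete or not: the bound by the norm holds in the completion of [(A, N)], and
    SEP carries it back to [A]. *)
Lemma SEP_spectral_radius_le (A : nonUnitalAlgType C) (a : A) (N : algNorm A) :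
  SEP A -> spectral_radius a <= N a.
Proof.
move=> /(_ _ _ (@completion_complete _ _ N) _ (@completion_injM _ _ N)).
move=> /(_ (@completion_inj_injective _ _ N)) ->.
rewrite -completion_injE; apply: spectral_radius_le_norm.
exact: completion_complete.
Qed.

End SpectralRadius.

(** * Ideals and the Jacobson radical *)

Section Jacobson.
Context {K : comNzRingType} {A : nonUnitalAlgType K}.
Implicit Types (I M : set A) (a b x y u : A).

Lemma subspaceD I x y : is_subspace I -> I x -> I y -> I (x + y).
Proof. by case=> _ IZ Ix Iy; rewrite -[x]scale1r; exact: IZ. Qed.

Lemma subspaceZ I (k : K) x : is_subspace I -> I x -> I (k *: x).
Proof. by case=> I0 IZ Ix; rewrite -[_ *: _]addr0; exact: IZ. Qed.

Lemma subspaceB I x y : is_subspace I -> I x -> I y -> I (x - y).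
Proof.
by move=> sI Ix Iy; rewrite -scaleN1r; apply: subspaceD => //; exact: subspaceZ.
Qed.

(** If [a] in [I] lies outside a maximal modular left ideal [M] with right unit [u] modulo [M], then
    [M] and [a] generate everything, so [u = m + b] with [m] in [M] and [b] in [I].
    Quasi-invertibility puts [b] in [M], hence [u] in [M], and then every [y = (y - y u) + y u] is
    in [M]. *)
Lemma quasi_invertible_ideal_radical I : ideal I ->
  (forall b, I b -> exists c, c ** b = b + c) -> I `<=` @jacobson_radical K A.
Proof.
move=> [sI mI] qI a Ia M [[[sM mM] [u uP]] MT Mmax]; apply: contrapT => aM.
(* The multiples [k *: a] are included because [a] need not belong to [A a]. *)
pose L : set A := [set z | exists m k x, M m /\ z = m + (k *: a + x ** a)].
have ML : M `<=` L.
  move=> m Mm; exists m, 0, 0; split => //.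
  by rewrite scale0r nmul0l !addr0.
have LT : L = setT.
  apply: contrapT => LT; apply: aM; rewrite -(Mmax L) //.
    exists 0, 1, 0; split; first by case: sM.
    by rewrite scale1r nmul0l addr0 add0r.
  split.
    split; first by apply: ML; case: sM.
    move=> k _ _ [m [l [x [Mm ->]]]] [m' [l' [x' [Mm' ->]]]].
    exists (k *: m + m'), (k * l + l'), (k *: x + x').
    split; first by case: sM => _; apply.
    rewrite scalerDr addrACA; congr (_ + _).
    by rewrite scalerDr scalerA addrACA -scalerDl -nmulZl -nmulDl.
  move=> z _ [m [l [x [Mm ->]]]]; exists (z ** m), 0, (l *: z + z ** x).
  split; first exact: mM.
  by rewrite scale0r add0r !nmulDr nmulDl nmulZl nmulZr nmulA.
have : L u by rewrite LT.
move=> [m [k [x [Mm uE]]]]; set b := k *: a + _ in uE.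
have Ib : I b.
  by apply: subspaceD => //; [exact: subspaceZ | case: (mI x _ Ia)].
have [c cb] := qI _ Ib.
have Mub : M (u - b) by rewrite uE addrK.
have Mb : M b.
  (* This element equals [c - c b = - b]; its first summand is in [M] by modularity, its second
     because [M] is a left ideal. *)
  have : M ((c - c ** u) + c ** (u - b)).
    by apply: subspaceD => //; exact: mM.
  rewrite nmulBr addrA subrK cb opprD addrCA subrr addr0.
  move=> Mb; rewrite -[b]opprK -sub0r; apply: subspaceB => //; by case: sM.
have Mu : M u by rewrite uE; exact: subspaceD.
apply: MT; apply/seteqP; split => // y _.
by rewrite -(subrK (y ** u) y); apply: subspaceD => //; exact: mM.
Qed.

End Jacobson.

(** * Permanent spectral radius and P-property *)

Section PermanentRadius.
Context {R : realType}.
Local Notation C := R[i].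
Local Notation normc := Normc.normc.
Implicit Type A B : nonUnitalAlgType C.

Lemma permanent_radius_le A (N : algNorm A) a : permanent_radius a <= N a.
Proof.
by apply: ge_inf; [exists 0 => _ [M _ <-]; exact: algnorm_ge0 | exists N].
Qed.

(* A needs a norm here: the infimum of the empty set is 0. *)
Lemma le_permanent_radius A (N : algNorm A) (a : A) (r : R) :
  (forall M : algNorm A, r <= M a) -> r <= permanent_radius a.
Proof.
move=> rM; apply: lb_le_inf; first by exists (N a), N.
by move=> _ [M _ <-].
Qed.

Lemma seminorm_preimage A B (N : algNorm B) (f : {linear A -> B}) :
  algebra_hom f -> seminorm_axioms (N \o f).
Proof.
move=> fM; split=> [x y|k x|x y] /=.
- by rewrite raddfD algnormD.
- by rewrite linearZ algnormZ.
- by rewrite fM algnormM.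
Qed.

(** Every norm on [B] pulls back along [f] to a norm on [A], so the infimum for [a] runs over at
    least the values occurring for [f a]. *)
Lemma permanent_radius_hom A B (N : algNorm B) (f : {linear A -> B}) a :
  algebra_hom f -> injective f -> permanent_radius a <= permanent_radius (f a).
Proof.
move=> fM fI; apply: (le_permanent_radius N) => M.
have f0 x : (M \o f) x = 0 -> x = 0.
  by move=> /= /algnorm_eq0 fx; apply: fI; rewrite fx raddf0.
exact: (permanent_radius_le (seminorm_algnorm (seminorm_preimage M fM) f0)).
Qed.

(* Unlike P-property, this asks for the ideals which are not closed too. *)
Definition strong_P_property A := forall I : set A, ideal I ->
  (exists x, I x /\ x <> 0) -> exists a, I a /\ 0 < permanent_radius a.

Lemma strong_P_property_closed A (N : algNorm A) :
  strong_P_property A -> P_property N.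
Proof. by move=> PA I Iideal _; exact: PA. Qed.

Lemma seminorm_ker_ideal A (p : A -> R) :
  seminorm_axioms p -> ideal [set x | p x = 0].
Proof.
move=> pS; have p0 x : p x <= 0 -> p x = 0.
  by move=> px; apply/eqP; rewrite eq_le px seminorm_ge0.
split=> [|x y /= y0]; last first.
  by split; apply: p0; rewrite (le_trans (seminormM pS _ _))// y0 ?mulr0 ?mul0r.
split=> [|k x y /= x0 y0]; first exact: seminorm0.
apply: p0; apply: le_trans (seminormD pS _ _) _.
by rewrite (seminormZ pS) x0 y0 mulr0 addr0.
Qed.

(** The kernel of [p] is an ideal on which the permanent radius is at most 0. Nothing makes this
    kernel closed, hence the strong form of the property. *)
Lemma strong_P_seminorm_eq0 A (p : A -> R) (x : A) :
  strong_P_property A -> seminorm_axioms p ->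
  (forall a, permanent_radius a <= p a) -> p x = 0 -> x = 0.
Proof.
move=> PA pS rp px; apply: contrapT => x0.
have [|a [/= pa]] := PA _ (seminorm_ker_ideal pS); first by exists x.
by rewrite ltNge -pa rp.
Qed.

Lemma ideal_preimage A B (f : {linear A -> B}) (I : set B) :
  algebra_hom f -> ideal I -> ideal (f @^-1` I).
Proof.
move=> fM [[I0 IZ] IM]; split; last first.
  by move=> x y /= /(IM (f x)); rewrite !fM.
split=> [|k x y Ix Iy]; rewrite /preimage/= ?raddf0//.
by rewrite linearP; exact: IZ.
Qed.

(** Transfer to a larger algebra for an ideal with nonzero trace on [A]; it serves both the
    unitization and the completion. *)
Lemma strong_P_hom A B (N : algNorm B) (f : {linear A -> B}) (I : set B) :
  strong_P_property A -> algebra_hom f -> injective f -> ideal I ->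
  (exists x, I (f x) /\ x <> 0) -> exists b, I b /\ 0 < permanent_radius b.
Proof.
move=> PA fM fI Iideal Ix; have [a [Ia a0]] := PA _ (ideal_preimage fM Iideal) Ix.
by exists (f a); split => //; exact/(lt_le_trans a0)/permanent_radius_hom.
Qed.

(** * Minimal norms by Zorn's lemma *)

Lemma majorized_minimal_norm A (M : algNorm A) : strong_P_property A ->
  exists M0 : algNorm A, minimal_norm M0 /\ majorizes M M0.
Proof.
move=> PA; pose T := {L : algNorm A | majorizes M L}.
(* The order is reversed: going up means passing to a smaller norm, so a maximal element is a
   minimal norm. *)
pose le (L1 L2 : T) := `[< majorizes (sval L1) (sval L2) >].
have MM : majorizes M M by move=> x.
have [||S Stot|[L ML] Lmin] := @ZL_preorder T (exist _ M MM) le.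
- by move=> L; apply/asboolP => x.
- move=> L2 L1 L3 /asboolP L12 /asboolP L23; apply/asboolP => x.
  exact: le_trans (L23 x) (L12 x).
(* The empty chain is bounded by [M] itself, any other by its pointwise infimum. *)
- have [[L0 SL0]|S0] := pselect (exists L, S L); last first.
    by exists (exist _ M MM) => L SL; case: S0; exists L.
  pose V x := [set sval L x | L in S].
  have V_neq0 x : V x !=set0 by exists (sval L0 x), L0.
  have V_ge0 x r : V x r -> 0 <= r by case=> L _ <-; exact: algnorm_ge0.
  (* Sums and products involve values of two norms of the chain; both are replaced by the smaller
     norm. *)
  have common L1 L2 : S L1 -> S L2 ->
      exists L, [/\ S L, majorizes (sval L1) (sval L)
                    & majorizes (sval L2) (sval L)].
    move=> S1 S2; have [/asboolP L12|/asboolP L21] := Stot _ _ S1 S2.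
      by exists L2; split => // x.
    by exists L1; split => // x.
  have VS : seminorm_axioms (fun x => inf (V x)).
    apply: inf_seminorm => //.
    + move=> x y _ _ [L1 S1 <-] [L2 S2 <-].
      have [L [SL L1L L2L]] := common _ _ S1 S2.
      exists (sval L (x + y)); first by exists L.
      by rewrite (le_trans (algnormD _ _ _))// lerD.
    + move=> k x _ [L SL <-]; exists (sval L (k *: x)); first by exists L.
      by rewrite algnormZ.
    + move=> x y _ _ [L1 S1 <-] [L2 S2 <-].
      have [L [SL L1L L2L]] := common _ _ S1 S2.
      exists (sval L (x ** y)); first by exists L.
      by rewrite (le_trans (algnormM _ _ _))// ler_pM ?algnorm_ge0.
  (* Each norm of the chain is at least the permanent radius, hence so is the infimum. *)
  have V0 x : inf (V x) = 0 -> x = 0.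
    apply: (strong_P_seminorm_eq0 PA VS) => a; apply: lb_le_inf => //.
    by move=> _ [L _ <-]; exact: permanent_radius_le.
  have Vle L x : S L -> inf (V x) <= sval L x.
    by move=> SL; apply: inf_seminorm_le => //; exists L.
  have MV : majorizes M (seminorm_algnorm VS V0).
    by move=> x; exact: le_trans (Vle _ _ SL0) (svalP L0 x).
  by exists (exist _ _ MV) => L SL; apply/asboolP => x; exact: Vle.
(* A norm below [L] is also below [M], so it competes in [T]. *)
exists L; split => // L' LL' x; apply/eqP; rewrite eq_le LL' /=.
have ML' : majorizes M L' by move=> z; exact: le_trans (LL' z) (ML z).
by have /asboolP/(_ x) := Lmin (exist _ L' ML') (asboolT LL').
Qed.

(** * P-property from SEP, and its passage to the unitization *)

Lemma SEP_strong_P_property A (N : algNorm A) : complete_norm N ->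
  ~ has_identity A -> semisimple A -> SEP A -> strong_P_property A.
Proof.
move=> cN A1 ssA sepA I Iideal [x [Ix x0]]; apply: contrapT => noI.
have : jacobson_radical x; last by rewrite ssA.
apply: quasi_invertible_ideal_radical Ix => // b Ib.
have rb : spectral_radius b <= 0.
  rewrite leNgt; apply/negP => rb0; apply: noI; exists b; split => //.
  apply: lt_le_trans rb0 _; apply: (le_permanent_radius N) => M.
  exact: SEP_spectral_radius_le.
(* A spectral value 1 would give [1 <= spectral_radius b <= 0]. *)
have b1 : ~ spectrum b 1.
  move=> /(spectrum_le_radius cN); rewrite Normc.normc1.
  by move=> /le_trans/(_ rb); rewrite ler10.
have : invertible (unitization_one A)
    (1 *: unitization_one A - unitization_inj b).
  by apply: contrapT => nb; apply: b1; right.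
(* The inverse of [1 - b] has scalar part 1, so it is [1 + y], and [- y] is the left quasi-inverse
   sought. *)
move=> [[y l] [_ []]] /=; rewrite scaler0 sub0r subr0 scale1r => yb.
rewrite mulr1 => l1; exists (- y).
move: yb; rewrite l1 scale1r nmulNr nmulNl => yb.
by apply/eqP; rewrite -subr_eq0 opprD opprK addrA -{2}[y]scale1r yb.
Qed.

(** Let [z = x + l 1] be a nonzero element of [J]. If [l = 0], it is in [A]. Otherwise [z b] and
    [b z] lie in both [J] and [A] for each [b] in [A]; if they all vanished, then
    [x b = b x = - l b] and [- x / l] would be an identity of [A]. *)
Lemma unitization_ideal_meets A (J : set (unitization A)) :
  ~ has_identity A -> ideal J -> (exists z, J z /\ z <> 0) ->
  exists a, J (unitization_inj a) /\ a <> 0.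
Proof.
move=> A1 [sJ mJ] [[x l] [Jz z0]]; apply: contrapT => noJ.
have J0 a : J (unitization_inj a) -> a = 0.
  by move=> Ja; apply: contrapT => a0; apply: noJ; exists a.
have [l0|l0] := eqVneq l 0.
  by apply: z0; congr pair => //; apply: J0; rewrite /unitization_inj -l0.
apply: A1; exists (- l^-1 *: x) => b.
have [Jbz Jzb] := mJ (unitization_inj b) _ Jz.
have xb : x ** b + l *: b = 0.
  apply: J0; rewrite (_ : unitization_inj _ =
    ((x, l) : unitization A) ** unitization_inj b) //.
  by congr pair; rewrite /= ?scale0r ?addr0 ?mulr0.
have bx : b ** x + l *: b = 0.
  apply: J0; rewrite (_ : unitization_inj _ =
    unitization_inj b ** ((x, l) : unitization A)) //.
  by congr pair; rewrite /= ?scale0r ?addr0 ?mul0r.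
move/eqP: xb; rewrite addr_eq0 => /eqP xb; move/eqP: bx; rewrite addr_eq0 => /eqP bx.
by rewrite nmulZl nmulZr xb bx scaleNr scalerN opprK scalerA mulVf// scale1r.
Qed.

Lemma strong_P_unitization A (N : algNorm A) : ~ has_identity A ->
  strong_P_property A -> strong_P_property (unitization A).
Proof.
move=> A1 PA J Jideal /(unitization_ideal_meets A1 Jideal).
apply: (strong_P_hom (unitization_norm N) PA) => //.
- exact: unitization_injM.
- exact: unitization_inj_injective.
Qed.

(** * Closed ideals in the completion for a minimal norm *)

Lemma closed_norm A (N : algNorm A) (I : set A) x :
  closed (I : set (normed_by N)) ->
  (forall e : R, 0 < e -> exists2 y, I y & N (x - y) < e) -> I x.
Proof.
move=> cI xI; apply: cI => U /nbhs_ballP[_/complex_gt0P[e e0 ->]] xU.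
have [y Iy xy] := xI _ e0; exists y; split => //; apply: xU.
by rewrite normed_by_ball.
Qed.

Lemma dense_norm A (N : algNorm A) (D : set A) x (e : R) :
  dense (D : set (normed_by N)) -> 0 < e -> exists2 y, D y & N (x - y) < e.
Proof.
move=> dD e0; have eC : 0 < e%:C%C by rewrite ltcR.
have [||y [xy Dy]] := dD (ball (x : normed_by N) e%:C%C)^°.
- by exists x; exact: nbhsx_ballx.
- exact: open_interior.
by exists y => //; have := interior_subset xy; rewrite normed_by_ball.
Qed.

Lemma minimal_norm_completion A (M : algNorm A) B (NB : algNorm B)
    (f : {linear A -> B}) : strong_P_property A -> minimal_norm M ->
  is_completion M NB f -> P_property NB.
Proof.
move=> PA Mmin [_ fM fN fD] I Iideal Icl [y [Iy y0]].
have fI : injective f.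
  move=> a b ab; apply/eqP; rewrite -subr_eq0; apply/eqP/(algnorm_eq0 (a := M)).
  have fB : f (a - b) = f a - f b by exact: raddfB.
  by rewrite -fN fB ab subrr algnorm0.
apply: (strong_P_hom NB PA fM fI Iideal); apply: contrapT => noI.
have I0 x : I (f x) -> x = 0.
  by move=> Ix; apply: contrapT => x0; apply: noI; exists x.
have [sI mI] := Iideal.
(* The infimum of [V x] is the distance from [f x] to [I]. *)
pose V x := [set NB (f x - z) | z in I].
have V_neq0 x : V x !=set0 by exists (NB (f x - y)), y.
have V_ge0 x r : V x r -> 0 <= r by case=> z _ <-; exact: algnorm_ge0.
have VS : seminorm_axioms (fun x => inf (V x)).
  apply: inf_seminorm => //.
  - move=> x x' _ _ [z Iz <-] [z' Iz' <-]; exists (NB (f (x + x') - (z + z'))).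
      by exists (z + z') => //; exact: subspaceD.
    by rewrite raddfD opprD addrACA algnormD.
  - move=> k x _ [z Iz <-]; exists (NB (f (k *: x) - k *: z)).
      by exists (k *: z) => //; exact: subspaceZ.
    by rewrite linearZ -scalerBr algnormZ.
  - move=> x x' _ _ [z Iz <-] [z' Iz' <-].
    (* Chosen so that [(f x - z) (f x' - z') = f (x x') - w], with [w] in [I]. *)
    pose w := f x ** z' + z ** (f x' - z').
    exists (NB (f (x ** x') - w)).
      exists w => //; apply: subspaceD => //; first exact: (mI _ _ Iz').1.
      exact: (mI _ _ Iz).2.
    apply: le_trans (algnormM _ _ _); rewrite fM /w opprD addrA.
    by rewrite -nmulBr -nmulBl.
have Vle x z : I z -> inf (V x) <= NB (f x - z).
  by move=> Iz; apply: inf_seminorm_le => //; exists z.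
(* Distance zero puts [f x] in the closed ideal [I], which meets the image of [f] only in 0. *)
have V0 x : inf (V x) = 0 -> x = 0.
  move=> Vx; apply: I0; apply: closed_norm Icl _ => e e0.
  have [|_ [z Iz <-] ze] := @inf_adherent _ (V x) _ e0.
    by split => //; exists 0 => ? /V_ge0.
  by exists z => //; rewrite Vx add0r in ze.
(* The point 0 of [I] shows that the distance is at most [M x]; minimality of [M] gives equality. *)
have VM : forall x, inf (V x) = M x.
  apply: (Mmin (seminorm_algnorm VS V0)) => x.
  by rewrite /= -fN -[f x]subr0; apply: Vle; case: sI.
(* Take [f x] within [NB y / 2] of [y]. As [y] is in [I], the norm [M x], being the distance to [I],
   is also below [NB y / 2], and the triangle inequality gives [NB y < NB y]. *)
have e0 : 0 < NB y / 2 by rewrite divr_gt0// algnorm_gt0.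
have [_ [x _ <-] xy] := dense_norm y fD e0.
suff : NB (y - 0) < NB y by rewrite subr0 ltxx.
apply: algnorm_dist_split (xy) _; rewrite subr0 fN -VM.
by apply: le_lt_trans (Vle _ _ Iy) _; rewrite algnorm_distC.
Qed.

End PermanentRadius.

Theorem theorem2p6 (R : realType) (A : nonUnitalAlgType R[i]) (N : algNorm A)
    (A_banach : complete_norm N) (A_nonunital : ~ has_identity A)
    (A_semisimple : semisimple A) (A_SEP : SEP A) :
  [/\ P_property N,
      (forall M : algNorm A,
         exists M0 : algNorm A, minimal_norm M0 /\ majorizes M M0),
      P_property (unitization_norm N),
      (forall M : algNorm (unitization A),
         exists M0 : algNorm (unitization A),
           minimal_norm M0 /\ majorizes M M0) &
      (forall M : algNorm (unitization A), minimal_norm M ->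
         forall (B : nonUnitalAlgType R[i]) (NB : algNorm B)
                (iota : {linear unitization A -> B}),
           is_completion M NB iota -> P_property NB)].
Proof.
have PA : strong_P_property A.
  exact: SEP_strong_P_property A_banach A_nonunital A_semisimple A_SEP.
have PAe : strong_P_property (unitization A).
  exact: strong_P_unitization N A_nonunital PA.
split.
- exact: strong_P_property_closed.
- by move=> M; exact: majorized_minimal_norm.
- exact: strong_P_property_closed.
- by move=> M; exact: majorized_minimal_norm.
- by move=> M Mmin B NB iota; exact: minimal_norm_completion.
Qed.
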